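(* Let $G$ be a six-dimensional almost abelian Lie group not admitting left-invariant Kähler structures. Then $G$ does not admit any non-split left-invariant generalized Kähler structures.
   Context: An almost abelian Lie group is a (real) connected Lie group whose Lie algebra has a codimension-one abelian ideal; throughout, such groups are assumed connected and simply connected. A Hermitian structure $(J,g)$ is a pair of an (integrable) complex structure $J$ and a Riemannian metric $g$ with $g(J\cdot,J\cdot)=g(\cdot,\cdot)$; its fundamental form is $\omega(\cdot,\cdot)=g(J\cdot,\cdot)$. It is Kähler if $d\omega=0$. A generalized Kähler structure is (equivalently) a triple $(J_+,J_-,g)$, where $J_\pm$ are two complex structures and $g$ is a Riemannian metric Hermitian with respect to both $J_+$ and $J_-$, such that $d^c_+\omega_++d^c_-\omega_-=0$ and $dd^c_+\omega_+=dd^c_-\omega_-=0$, where $\omega_\pm(\cdot,\cdot)=g(J_\pm\cdot,\cdot)$ and $d^c_\pm=i(\overline\partial_\pm-\partial_\pm)$ is the operator associated with $J_\pm$. It is split if $J_+J_-=J_-J_+$ and non-split otherwise; it is left-invariant if $J_+,J_-,g$ are left-invariant. *)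

(* Defs.v *)
From HB Require Import structures.
From mathcomp Require Import all_boot all_order all_algebra.
From mathcomp Require Import reals complex.

Set Implicit Arguments.
Unset Strict Implicit.
Unset Printing Implicit Defensive.

Import GRing.Theory.
Local Open Scope ring_scope.

(* A connected, simply connected Lie group G is determined by its Lie algebra, *)
(* every finite-dimensional real Lie algebra occurs, and evaluation at the     *)
(* identity identifies left-invariant tensor fields on G with tensors on the   *)
(* Lie algebra.  On left-invariant forms the exterior derivative is given by   *)
(* Koszul's formula without its derivative terms, i.e., it is the              *)
(* Chevalley-Eilenberg differential.  So G is represented by the pair (V, br)  *)
(* of a finite-dimensional real vector space and a Lie bracket on it, and      *)
(* left-invariant structures on G are linear structures on V.                  *)

Section LieAlgebra.
Variables (R : realType) (V : vectType R).

Record lie_bracket (br : {bilinear V -> V -> V}) : Prop := LieBracket {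
  bracket_alternating : forall x : V, br x x = 0;
  bracket_jacobi : forall x y z : V,
    br x (br y z) + br y (br z x) + br z (br x y) = 0 }.

Definition abelian_ideal (br : {bilinear V -> V -> V}) (n : {vspace V}) : Prop :=
  (forall x y : V, y \in n -> br x y \in n) /\
  (forall x y : V, x \in n -> y \in n -> br x y = 0).

Definition almost_abelian (br : {bilinear V -> V -> V}) : Prop :=
  exists2 n : {vspace V}, (\dim n).+1 = \dim {:V} & abelian_ideal br n.

(* The type does not impose multilinearity or alternation: the operators below *)
(* are only applied to maps that have both properties.                         *)
Definition kform (K : pzRingType) (k : nat) := {ffun 'I_k -> V} -> K.

Definition ffun_cons (k : nat) (x : V) (v : {ffun 'I_k -> V}) :
    {ffun 'I_k.+1 -> V} :=
  [ffun m => oapp v x (unlift ord0 m)].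

Section Differential.
Variables (br : {bilinear V -> V -> V}) (K : pzRingType).

(* The sum is over pairs of positions i < j', where j' = lift i j = j.+1, of   *)
(* (-1) ^ (i + j') * alpha ([v_i, v_j'], v_0, ... without v_i, v_j' ..., v_k.+1). *)
(* Left-invariant functions are constant, so d vanishes in degree 0.           *)
Definition ext_d (k : nat) : kform K k -> kform K k.+1 :=
  match k return kform K k -> kform K k.+1 with
  | 0 => fun _ _ => 0
  | k'.+1 => fun alpha v =>
      \sum_(i < k'.+2) \sum_(j < k'.+1 | (i <= j)%N)
        (-1) ^+ (i + j.+1) *
        alpha (ffun_cons (br (v i) (v (lift i j)))
                         [ffun m => v (lift i (lift j m))])
  end.

End Differential.

Section Dolbeault.
Variables (br : {bilinear V -> V -> V}) (J : 'End(V)).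

(* The component of bidegree (p, k - p).  It is the complex-multilinear        *)
(* extension of alpha evaluated, summing over the sets S of p arguments, at    *)
(* the (1,0)-parts (v_j - i J v_j) / 2 of the arguments with j in S and at     *)
(* the (0,1)-parts (v_j + i J v_j) / 2 of the others; the sum over T expands   *)
(* this by multilinearity, T being the set of arguments where J v_j is chosen. *)
Definition bidegree_part (k p : nat) (alpha : kform R[i] k) : kform R[i] k :=
  fun v => 2 ^- k *
    \sum_(S : {set 'I_k} | #|S| == p) \sum_(T : {set 'I_k})
      (\prod_(j in T) (if j \in S then - 'i%C else 'i%C)) *
      alpha [ffun j => if j \in T then J (v j) else v j].

(* On forms of type (p, q), del is the (p+1, q)-part of d and delbar is the    *)
(* (p, q+1)-part.                                                              *)
Definition del (k : nat) (alpha : kform R[i] k) : kform R[i] k.+1 :=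
  fun v => \sum_(p < k.+1)
    bidegree_part p.+1 (ext_d br (bidegree_part p alpha)) v.

Definition delbar (k : nat) (alpha : kform R[i] k) : kform R[i] k.+1 :=
  fun v => \sum_(p < k.+1)
    bidegree_part p (ext_d br (bidegree_part p alpha)) v.

Definition dc (k : nat) (alpha : kform R[i] k) : kform R[i] k.+1 :=
  fun v => 'i%C * (delbar alpha v - del alpha v).

End Dolbeault.

(* Integrability is the vanishing of the Nijenhuis tensor.                     *)
Definition complex_structure (br : {bilinear V -> V -> V}) (J : 'End(V)) : Prop :=
  (forall x : V, J (J x) = - x) /\
  (forall x y : V,
     br (J x) (J y) - J (br (J x) y) - J (br x (J y)) - br x y = 0).

(* Left-invariant Riemannian metrics are inner products g : {dot V for idfun}. *)
Definition hermitian_structure (br : {bilinear V -> V -> V})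
    (J : 'End(V)) (g : {dot V for idfun}) : Prop :=
  complex_structure br J /\ (forall x y : V, g (J x) (J y) = g x y).

Definition fundamental_form (J : 'End(V)) (g : {dot V for idfun}) : kform R 2 :=
  fun v => g (J (v ord0)) (v ord_max).

Definition complexify (k : nat) (alpha : kform R k) : kform R[i] k :=
  fun v => (alpha v)%:C%C.

Definition kahler (br : {bilinear V -> V -> V})
    (J : 'End(V)) (g : {dot V for idfun}) : Prop :=
  hermitian_structure br J g /\
  (forall v, ext_d br (fundamental_form J g) v = 0).

Definition generalized_kahler (br : {bilinear V -> V -> V})
    (Jp Jm : 'End(V)) (g : {dot V for idfun}) : Prop :=
  let dc_p := dc br Jp (complexify (fundamental_form Jp g)) in
  let dc_m := dc br Jm (complexify (fundamental_form Jm g)) in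
  [/\ hermitian_structure br Jp g,
      hermitian_structure br Jm g,
      forall v, dc_p v + dc_m v = 0,
      forall v, ext_d br dc_p v = 0
    & forall v, ext_d br dc_m v = 0].

Definition is_split (Jp Jm : 'End(V)) : Prop := (Jp \o Jm = Jm \o Jp)%VF.

End LieAlgebra.

(* Main.v *)
Require Import Defs.
From mathcomp Require Import all_boot all_order all_algebra.
From mathcomp Require Import boolp reals complex ring lra.

(** Let T_J(x, y, z) = g([Jx, Jy], z) + g([Jy, Jz], x) + g([Jz, Jx], y).
For a Hermitian structure (J, g) the 3-form d^c omega equals T_J
([dc_fundamental_form]), and (J, g) is Kaehler as soon as T_J = 0
([kahler_torsion0]).  A generalized Kaehler structure (J, K, g) thus satisfies
T_J + T_K = 0 with both terms closed, and it suffices to show that T_J = 0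
unless J and K commute.

Let e be a unit normal of the abelian ideal, D = ad e, u = J e and v = K e.
The bracket is [x, y] = g(x, e) D y - g(y, e) D x, and integrability of J says
that D preserves the orthogonal complement of {e, u} and commutes with J on it
([D_tangent], [DJ]).  If moreover D u is orthogonal to that complement, on
which D is skew, then T_J = 0 ([kahler_criterion]).

If u and v are parallel, then after a change of sign of K they are equal.  The
values T(e, u, x) force D u to be a multiple of u, and the values T(u, x, y)
make D skew on the image of J + K.  So T_J = 0 if J + K is invertible.
Otherwise J = - K on some J-stable and K-stable plane orthogonal to {e, u}; in
dimension six the orthogonal complement of this plane and of {e, u} is again a
plane, on which J = K or J = - K, and so J and K commute.

If u and v are independent, let w be the component of v orthogonal to u and w'
that of u orthogonal to v.  Then T_J + T_K = 0 makes w and w' eigenvectors of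
D, with eigenvalues k and k', and g(D u, u) = k'.  Closedness of T_J at
(e, u, w, J w) reads k (k' + 2 k) = 0, and that of T_K reads k' (k + 2 k') = 0;
hence k = k' = 0.  So D kills u, w and J w, and it is skew on what remains:
again T_J = 0. *)

Set Implicit Arguments.
Unset Strict Implicit.
Unset Printing Implicit Defensive.

Import Order.TTheory GRing.Theory Num.Theory.
Local Open Scope ring_scope.

(** * Sums over the subsets of an ordinal *)

Section SetCons.
Variable n : nat.

Definition set_cons (b : bool) (S : {set 'I_n}) : {set 'I_n.+1} :=
  [set i | oapp (fun j => j \in S) b (unlift ord0 i)].

Lemma in_set_cons0 b S : (ord0 \in set_cons b S) = b.
Proof. by rewrite inE unlift_none. Qed.

Lemma in_set_consS b S j : (lift ord0 j \in set_cons b S) = (j \in S).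
Proof. by rewrite inE liftK. Qed.

Lemma card_set_cons b S : #|set_cons b S| = (b + #|S|)%N.
Proof.
rewrite -!sum1_card big_mkcond big_ord_recl in_set_cons0.
rewrite [in RHS]big_mkcond; congr addn.
by apply: eq_bigr => j _; rewrite in_set_consS.
Qed.

Lemma prod_set_cons (K : pzSemiRingType) b S (F : 'I_n.+1 -> K) :
  \prod_(i in set_cons b S) F i =
  (if b then F ord0 else 1) * \prod_(j in S) F (lift ord0 j).
Proof.
rewrite big_mkcond big_ord_recl in_set_cons0; congr (_ * _).
by rewrite [in RHS]big_mkcond; apply: eq_bigr => j _; rewrite in_set_consS.
Qed.

Lemma sum_set_cons (U : nmodType) b (F : {set 'I_n.+1} -> U) :
  \sum_(S : {set 'I_n.+1} | (ord0 \in S) == b) F S = \sum_S F (set_cons b S).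
Proof.
rewrite (reindex (set_cons b)) /=.
  by apply: eq_bigl => S; rewrite in_set_cons0 eqxx.
exists (fun S : {set 'I_n.+1} => [set j : 'I_n | lift ord0 j \in S]) => S.
  by move=> _; apply/setP=> j; rewrite inE in_set_consS.
rewrite inE => /eqP S0; apply/setP => i.
by case: (unliftP ord0 i) => [j|] ->; rewrite ?in_set_cons0 ?in_set_consS ?inE.
Qed.

Lemma sum_set_ord_recl (U : nmodType) (F : {set 'I_n.+1} -> U) :
  \sum_S F S = \sum_S F (set_cons true S) + \sum_S F (set_cons false S).
Proof.
rewrite -!sum_set_cons (bigID (fun S : {set _} => ord0 \in S)) /=.
by congr (_ + _); apply: eq_bigl => S; case: (_ \in _).
Qed.

End SetCons.

Lemma sum_set_ord0 (U : nmodType) (F : {set 'I_0} -> U) : \sum_S F S = F set0.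
Proof.
rewrite (bigD1 set0) //= big1 ?addr0 // => S /negP[]; apply/eqP/setP.
by case.
Qed.

(** * Forms of low degree *)

Section Forms.
Variables (R : realType) (V : vectType R).
Implicit Types (x y z : V) (br : {bilinear V -> V -> V}) (J : 'End(V)).

Definition vec2 x y : {ffun 'I_2 -> V} := [ffun i : 'I_2 => nth 0 [:: x; y] i].
Definition vec3 x y z : {ffun 'I_3 -> V} :=
  [ffun i : 'I_3 => nth 0 [:: x; y; z] i].
Definition vec4 x y z w : {ffun 'I_4 -> V} :=
  [ffun i : 'I_4 => nth 0 [:: x; y; z; w] i].

Lemma vec2E (f : 'I_2 -> V) :
  [ffun i => f i] = vec2 (f ord0) (f (lift ord0 ord0)).
Proof.
apply/ffunP => i; rewrite !ffunE.
by case: i => [[|[|[]]]] //= p; congr f; apply: val_inj.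
Qed.

Lemma vec3E (f : 'I_3 -> V) :
  [ffun i => f i] =
  vec3 (f ord0) (f (lift ord0 ord0)) (f (lift ord0 (lift ord0 ord0))).
Proof.
apply/ffunP => i; rewrite !ffunE.
by case: i => [[|[|[|[]]]]] //= p; congr f; apply: val_inj.
Qed.

(** With [c k = - 'i] or [c k = 'i] this is the value of a multilinear form at
the (1,0)- or (0,1)-parts of its arguments, up to the power of 2. *)
Lemma sum_subsets2 J (c : 'I_2 -> R[i]) (a : kform V R[i] 2)
    (v : {ffun 'I_2 -> V}) :
  let i := ord0 in let j := lift ord0 ord0 in
  let x := v i in let y := v j in
  \sum_(T : {set 'I_2})
    (\prod_(k in T) c k) * a [ffun k => if k \in T then J (v k) else v k] =
  a (vec2 x y) + (c i * a (vec2 (J x) y) + c j * a (vec2 x (J y)))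
  + c i * c j * a (vec2 (J x) (J y)).
Proof.
move=> i j x y; do !rewrite sum_set_ord_recl; rewrite !sum_set_ord0.
do !rewrite prod_set_cons; rewrite !big_set0 !vec2E.
do !rewrite ?in_set_cons0 ?in_set_consS.
rewrite -/i -/j -/x -/y /=; ring.
Qed.

Lemma bidegree2 J p (a : kform V R[i] 2) (v : {ffun 'I_2 -> V}) :
  let x := v ord0 in let y := v (lift ord0 ord0) in
  let mixed := a (vec2 (J x) y) + a (vec2 x (J y)) in
  bidegree_part J p a v = 4^-1 *
    match p with
    | 0 => a (vec2 x y) + 'i%C * mixed - a (vec2 (J x) (J y))
    | 1 => 2 * (a (vec2 x y) + a (vec2 (J x) (J y)))
    | 2 => a (vec2 x y) - 'i%C * mixed - a (vec2 (J x) (J y))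
    | _ => 0
    end.
Proof.
move=> x y; have i2 : 'i%C * 'i%C = -1 :> R[i] by rewrite -expr2 sqr_i.
rewrite /bidegree_part; congr (_ * _); first by rewrite -natrX.
under eq_bigr do rewrite sum_subsets2 -/x -/y.
rewrite big_mkcond; do !rewrite sum_set_ord_recl; rewrite !sum_set_ord0.
do !rewrite card_set_cons; rewrite cards0.
do !rewrite ?in_set_cons0 ?in_set_consS.
move: (a _) (a _) (a _) (a _) => a1 a2 a3 a4.
by case: p => [|[|[|p]]] /=; ring: i2.
Qed.

Lemma sum_subsets3 J (c : 'I_3 -> R[i]) (a : kform V R[i] 3)
    (v : {ffun 'I_3 -> V}) :
  let i := ord0 in let j := lift ord0 ord0 in
  let k := lift ord0 (lift ord0 ord0) in
  let x := v i in let y := v j in let z := v k in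
  \sum_(T : {set 'I_3})
    (\prod_(l in T) c l) * a [ffun l => if l \in T then J (v l) else v l] =
  a (vec3 x y z)
  + (c i * a (vec3 (J x) y z) + c j * a (vec3 x (J y) z)
     + c k * a (vec3 x y (J z)))
  + (c i * c j * a (vec3 (J x) (J y) z) + c j * c k * a (vec3 x (J y) (J z))
     + c i * c k * a (vec3 (J x) y (J z)))
  + c i * c j * c k * a (vec3 (J x) (J y) (J z)).
Proof.
move=> i j k x y z; do !rewrite sum_set_ord_recl; rewrite !sum_set_ord0.
do !rewrite prod_set_cons; rewrite !big_set0 !vec3E.
do !rewrite ?in_set_cons0 ?in_set_consS.
rewrite -/i -/j -/k -/x -/y -/z /=; ring.
Qed.

(** In the difference the terms with an even number of arguments [J _] cancel,
because the (1,2)- and the (2,1)-part have conjugate coefficients. *)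
Lemma bidegree3_diff J (a : kform V R[i] 3) (v : {ffun 'I_3 -> V}) :
  let x := v ord0 in let y := v (lift ord0 ord0) in
  let z := v (lift ord0 (lift ord0 ord0)) in
  'i%C * (bidegree_part J 1 a v - bidegree_part J 2 a v) =
  - (4^-1 * (a (vec3 (J x) y z) + a (vec3 x (J y) z) + a (vec3 x y (J z))
             + 3 * a (vec3 (J x) (J y) (J z)))).
Proof.
move=> x y z; have i2 : 'i%C * 'i%C = -1 :> R[i] by rewrite -expr2 sqr_i.
have -> : 4^-1 = 2 * 2 ^- 3 :> R[i].
  by apply: (@mulfI _ 4); rewrite ?pnatr_eq0 //; field.
rewrite /bidegree_part.
under eq_bigr do rewrite sum_subsets3 -/x -/y -/z.
under [in X in _ - X]eq_bigr do rewrite sum_subsets3 -/x -/y -/z.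
rewrite big_mkcond [in X in _ - X]big_mkcond /=.
do !rewrite sum_set_ord_recl; rewrite !sum_set_ord0.
do !rewrite card_set_cons; rewrite cards0.
do !rewrite ?in_set_cons0 ?in_set_consS.
move: (a _) (a _) (a _) (a _) (a _) (a _) (a _) (a _).
move=> a1 a2 a3 a4 a5 a6 a7 a8.
rewrite /= ?addr0 ?add0r.
move: (2 ^- 3) => q; ring: i2.
Qed.

Lemma ext_d2E br (K : pzRingType) (a : kform V K 2) (v : {ffun 'I_3 -> V}) :
  let x := v ord0 in let y := v (lift ord0 ord0) in
  let z := v (lift ord0 (lift ord0 ord0)) in
  ext_d br a v =
  - a (vec2 (br x y) z) + a (vec2 (br x z) y) - a (vec2 (br y z) x).
Proof.
move=> x y z; rewrite /ext_d.
have hv i : v i = nth 0 [:: x; y; z] i.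
  by case: i => [[|[|[|[]]]]] //= p; congr (v _); apply: val_inj.
under eq_bigr do rewrite big_mkcond.
rewrite !big_ord_recl !big_ord0 /= !addr0 ?add0r.
rewrite /ffun_cons !vec2E ?unlift_none ?liftK /= !ffunE !hv /=.
rewrite /bump /= !(add0n, addn1, addnS) !exprS !expr0 !mulr1.
by rewrite !(mulrNN, mulN1r, mul1r, opprK).
Qed.

Lemma ext_d3E br (K : pzRingType) (a : kform V K 3) (v : {ffun 'I_4 -> V}) :
  let x := v ord0 in let y := v (lift ord0 ord0) in
  let z := v (lift ord0 (lift ord0 ord0)) in
  let w := v (lift ord0 (lift ord0 (lift ord0 ord0))) in
  ext_d br a v =
   - a (vec3 (br x y) z w) + a (vec3 (br x z) y w) - a (vec3 (br x w) y z)
   - a (vec3 (br y z) x w) + a (vec3 (br y w) x z) - a (vec3 (br z w) x y).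
Proof.
move=> x y z w; rewrite /ext_d.
have hv i : v i = nth 0 [:: x; y; z; w] i.
  by case: i => [[|[|[|[|[]]]]]] //= p; congr (v _); apply: val_inj.
under eq_bigr do rewrite big_mkcond.
rewrite !big_ord_recl !big_ord0 /= !addr0 ?add0r.
rewrite /ffun_cons !vec3E ?unlift_none ?liftK /= !ffunE !hv /=.
rewrite /bump /= !(add0n, addn1, addnS) !exprS !expr0 !mulr1.
by rewrite !(mulrNN, mulN1r, mul1r, opprK) !addrA.
Qed.

Lemma ext_d0 br (K : pzRingType) k :
  @ext_d R V br K k (fun=> 0) = fun=> 0.
Proof.
case: k => [|k]; apply/funext => v //=.
by apply: big1 => i _; apply: big1 => j _; rewrite mulr0.
Qed.

Lemma bidegree_part0 J k p :
  @bidegree_part R V J k p (fun=> 0) = fun=> 0.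
Proof.
apply/funext => v; rewrite /bidegree_part big1 ?mulr0 // => S _.
by apply: big1 => T _; rewrite mulr0.
Qed.

Lemma ext_d_complexify br k (a : kform V R k) v :
  ext_d br (complexify a) v = (ext_d br a v)%:C%C.
Proof.
case: k a v => [|k] a v /=; first by rewrite rmorph0.
rewrite rmorph_sum; apply: eq_bigr => i _; rewrite rmorph_sum.
by apply: eq_bigr => j _; rewrite rmorphM rmorphXn rmorphN1.
Qed.

Lemma bracketC br x y : lie_bracket br -> br y x = - br x y.
Proof.
move=> [alt _]; apply/eqP; rewrite -addr_eq0; apply/eqP.
have := alt (x + y); rewrite linearDl !linearDr /= !alt add0r addr0 addrC.
by rewrite addrC.
Qed.

End Forms.

(** * The torsion of a Hermitian structure *)

Section Torsion.
Variables (R : realType) (V : vectType R) (g : {dot V for idfun}).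
Implicit Types (x y z : V) (br : {bilinear V -> V -> V}) (J : 'End(V)).

Lemma dotC x y : g x y = g y x.
Proof. by rewrite hermC expr0 mul1r. Qed.

Lemma dot_skew br J x y : hermitian_structure br J g -> g (J x) y = - g x (J y).
Proof. by case=> -[JJ _] gJ; rewrite -[in RHS]gJ JJ linearNr opprK. Qed.

(** The torsion 3-form of the Bismut connection. *)
Definition torsion br J x y z : R :=
  g (br (J x) (J y)) z + g (br (J y) (J z)) x + g (br (J z) (J x)) y.

Definition d_fundamental br J x y z : R :=
  g (br x y) (J z) + g (br y z) (J x) + g (br z x) (J y).

Lemma ext_d_fundamental br J (v : {ffun 'I_3 -> V}) :
  lie_bracket br -> hermitian_structure br J g ->
  ext_d br (fundamental_form J g) v =
  d_fundamental br J (v ord0) (v (lift ord0 ord0))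
                (v (lift ord0 (lift ord0 ord0))).
Proof.
move=> L H; rewrite ext_d2E /fundamental_form !ffunE /= !(dot_skew _ _ H).
rewrite /d_fundamental (bracketC (v (lift ord0 (lift ord0 ord0))) (v ord0) L).
rewrite !linearNl /=; ring.
Qed.

Lemma integrable_dot br J x y z : hermitian_structure br J g ->
  g (br (J x) (J y)) z
  = g (br x y) z - g (br (J x) y) (J z) - g (br x (J y)) (J z).
Proof.
move=> H; rewrite -!(dot_skew _ _ H); case: H => -[_ NJ] _.
have /eqP := NJ x y; rewrite !subr_eq add0r => /eqP ->.
by rewrite !linearDl /= addrAC.
Qed.

(** Equivalently, by [d_fundamentalJ], d omega has no components of bidegree
(3,0) and (0,3): this is what integrability contributes. *)
Lemma d_fundamental_bidegree br J x y z :
  hermitian_structure br J g ->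
  let b := d_fundamental br J in
  b (J x) y z + b x (J y) z + b x y (J z) = - torsion br J x y z.
Proof.
move=> H /=; rewrite /torsion !(integrable_dot _ _ _ H) /d_fundamental.
have JJ t : J (J t) = - t by case: H => -[].
rewrite !JJ !linearNr /=; ring.
Qed.

Lemma d_fundamentalJ br J x y z : hermitian_structure br J g ->
  d_fundamental br J (J x) (J y) (J z) = - torsion br J x y z.
Proof.
move=> H; have JJ t : J (J t) = - t by case: H => -[].
by rewrite /torsion /d_fundamental !JJ !linearNr /= !opprD.
Qed.

Lemma fundamental_form_bidegree br J p : hermitian_structure br J g ->
  bidegree_part J p (complexify (fundamental_form J g)) =
  if p == 1%N then complexify (fundamental_form J g) else fun=> 0.
Proof.
move=> H; apply/funext => v; rewrite bidegree2 /=.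
have JJ t : J (J t) = - t by case: H => -[].
have gJ t u : g (J t) (J u) = g t u by case: H.
rewrite /complexify /fundamental_form.
have -> : ord_max = lift ord0 ord0 :> 'I_2 by apply: val_inj.
rewrite !ffunE /= !JJ linearNl /= gJ -[g _ (J _)]opprK -(dot_skew _ _ H).
rewrite linearN linearNl /= opprK rmorphN.
by case: p => [|[|[|p]]] /=; [field|field|field|rewrite mulr0].
Qed.

(** Since omega has type (1,1), d^c omega is i times the difference of the
(1,2)- and (2,1)-parts of d omega, which is - d omega(J, J, J) because the other
two parts vanish. *)
Lemma dc_fundamental_form br J (v : {ffun 'I_3 -> V}) :
  lie_bracket br -> hermitian_structure br J g ->
  dc br J (complexify (fundamental_form J g)) v =
  (torsion br J (v ord0) (v (lift ord0 ord0))
           (v (lift ord0 (lift ord0 ord0))))%:C%C.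
Proof.
move=> L H; set a := complexify _.
have sum3 (F : nat -> R[i]) : \sum_(p < 3) F p = F 0 + F 1 + F 2.
  by rewrite !big_ord_recr big_ord0 /= add0r.
have a0 : bidegree_part J 0 a = fun=> 0.
  exact: @fundamental_form_bidegree _ _ 0%N H.
have a1 : bidegree_part J 1 a = a := @fundamental_form_bidegree _ _ 1%N H.
have a2 : bidegree_part J 2 a = fun=> 0.
  exact: @fundamental_form_bidegree _ _ 2%N H.
pose da p := ext_d br (bidegree_part J p a).
rewrite /dc /del /delbar (sum3 (fun p => bidegree_part J p (da p) v)).
rewrite (sum3 (fun p => bidegree_part J p.+1 (da p) v)) /da.
rewrite {}a0 {}a1 {}a2 !ext_d0 !bidegree_part0.
rewrite !(addr0, add0r) bidegree3_diff /a !ext_d_complexify.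
rewrite !(ext_d_fundamental _ L H) !ffunE /= (d_fundamentalJ _ _ _ H).
rewrite -!rmorphD (d_fundamental_bidegree _ _ _ H) /= rmorphN.
by field.
Qed.

Lemma ext_d_dc_fundamental br J x y z w :
  lie_bracket br -> hermitian_structure br J g ->
  let t := torsion br J in
  ext_d br (dc br J (complexify (fundamental_form J g))) (vec4 x y z w) =
  (- t (br x y) z w + t (br x z) y w - t (br x w) y z
   - t (br y z) x w + t (br y w) x z - t (br z w) x y)%:C%C.
Proof.
move=> L H t; rewrite ext_d3E !(dc_fundamental_form _ L H) !ffunE /=.
by rewrite !(rmorphD, rmorphN).
Qed.

Lemma kahler_torsion0 br J : lie_bracket br -> hermitian_structure br J g ->
  (forall x y z, torsion br J x y z = 0) -> kahler br J g.
Proof.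
move=> L H T0; split=> // v; rewrite (ext_d_fundamental _ L H).
have JJ t : J (- J t) = t.
  by case: (H) => -[JJ _] _; rewrite linearN /= JJ opprK.
move: (v ord0) (v (lift ord0 ord0)) (v (lift ord0 (lift ord0 ord0))) => x y z.
by rewrite -[x]JJ -[y]JJ -[z]JJ (d_fundamentalJ _ _ _ H) T0 oppr0.
Qed.

End Torsion.

(** * Orthogonality *)

Section InnerProduct.
Variables (R : realType) (V : vectType R) (g : {dot V for idfun}).
Implicit Types (x y z w : V) (U : {vspace V}) (s : seq V).

Lemma dot_eq0 x : (g x x == 0) = (x == 0).
Proof.
apply/eqP/eqP => [|->]; last exact: linear0l.
by apply: contra_eq => x0; rewrite gt_eqF // neq0_dnorm_gt0.
Qed.

Lemma dotDl x y z : g (x + y) z = g x z + g y z.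
Proof. exact: linearDl. Qed.

Lemma dotDr x y z : g x (y + z) = g x y + g x z.
Proof. exact: linearDr. Qed.

Lemma dotBl x y z : g (x - y) z = g x z - g y z.
Proof. exact: linearBl. Qed.

Lemma dotBr x y z : g x (y - z) = g x y - g x z.
Proof. exact: linearBr. Qed.

Lemma dotNl x y : g (- x) y = - g x y.
Proof. exact: linearNl. Qed.

Lemma dotNr x y : g x (- y) = - g x y.
Proof. exact: linearNr. Qed.

Lemma dotZl k x y : g (k *: x) y = k * g x y.
Proof. exact: linearZl_LR. Qed.

Lemma dotZr k x y : g x (k *: y) = k * g x y.
Proof. exact: linearZr_LR. Qed.

Lemma exists_orthogonal s U : (size s < \dim U)%N ->
  exists2 x, x != 0 & x \in U /\ {in s, forall y, g x y = 0}.
Proof.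
elim: s U => [|y s IHs] U /= ltsU.
  by exists (vpick U); rewrite ?vpick0 -?dimv_eq0 -?lt0n ?memv_pick.
have [|x x0 []] := IHs (U :&: orthov g <[y]>)%VS.
  apply: leq_trans (leq_dim_orthov1 g y U).
  by rewrite -ltnS (leq_trans ltsU) // leqSpred.
rewrite memv_cap mem_orthov1 => /andP[xU /eqP gxy] gxs; exists x => //.
by split=> // z; rewrite inE => /predU1P[->|/gxs].
Qed.

Lemma orthogonal_basis_eq0 s U w :
  0 \notin s -> pairwise (fun x y => g x y == 0) s ->
  {subset s <= U} -> size s = \dim U ->
  w \in U -> {in s, forall y, g w y = 0} -> w = 0.
Proof.
elim: s U => [|y s IHs] U /=.
  move=> _ _ _ /esym/eqP; rewrite dimv_eq0 => /eqP->.
  by rewrite memv0 => /eqP.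
rewrite inE negb_or => /andP[y0 s0] /andP[oys os].
move=> sU dimU wU gw; apply: (IHs (U :&: orthov g <[y]>)%VS) => //.
- move=> z zs; rewrite memv_cap mem_orthov1 sU ?inE ?zs ?orbT //= dotC.
  by move: oys => /allP; apply.
- rewrite -eq_dim_orthov1 -?dimU //.
  by apply/mem_orthovPn; exists y; rewrite ?sU ?mem_head // dot_eq0 eq_sym.
- by rewrite memv_cap wU mem_orthov1; apply/eqP/gw/mem_head.
- by move=> z zs; apply: gw; rewrite inE zs orbT.
Qed.

End InnerProduct.

Section AlmostAbelian.
Variables (R : realType) (V : vectType R) (br : {bilinear V -> V -> V}).
Variables (g : {dot V for idfun}).

(** * The unit normal of the abelian ideal *)

(** The abelian ideal can be recovered as the orthogonal complement of [e]. *)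
Definition unit_normal e :=
  [/\ g e e = 1, forall x y, br x y = g x e *: br e y - g y e *: br e x
    & forall x, g (br e x) e = 0].

Lemma exists_unit_normal :
  lie_bracket br -> almost_abelian br -> exists e, unit_normal e.
Proof.
move=> L [n dimn [idn abn]].
have [|f f0 [_ nf]] := @exists_orthogonal _ _ g (vbasis n) fullv.
  by rewrite size_tuple dimn.
have [e ee ne] : exists2 e, g e e = 1 & forall x, x \in n -> g x e = 0.
  exists ((Num.sqrt (g f f))^-1 *: f) => [|x /coord_vbasis->].
    rewrite linearZl_LR linearZr_LR /= mulrA -expr2 exprVn sqr_sqrtr; last first.
      by rewrite ltW // neq0_dnorm_gt0.
    by rewrite mulVf // dot_eq0.
  rewrite linear_sumlz big1 // => i _.
  rewrite linearZl_LR /= linearZr_LR /= [g _`_i f]dotC (nf _`_i) ?mulr0 //.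
  by rewrite mem_nth // size_tuple.
have nE x : (x \in n) = (g x e == 0).
  suff -> : n = orthov g <[e]> by rewrite mem_orthov1.
  apply/eqP; rewrite eqEdim; apply/andP; split.
    by apply/subvP => y /ne ye; rewrite mem_orthov1; apply/eqP.
  have eU : e \notin orthov g fullv.
    have ee0 : g e e != 0 by rewrite ee oner_eq0.
    by apply/mem_orthovPn; exists e; rewrite ?memvf.
  have := eq_dim_orthov1 eU; rewrite capfv => <-.
  by rewrite -dimn.
have nproj x : x - g x e *: e \in n.
  by rewrite nE linearBl /= linearZl_LR /= ee mulr1 subrr.
have alt := bracket_alternating L.
have bre x : br e x = br e (x - g x e *: e).
  by rewrite linearBr linearZr_LR /= alt scaler0 subr0.
exists e; split=> // [x y|x]; last first.
  by apply/eqP; rewrite -nE bre; apply: idn.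
rewrite [br e x]bre [br e y]bre.
rewrite -[in LHS](subrK (g x e *: e) x) -[in LHS](subrK (g y e *: e) y).
move: (nproj x) (nproj y); move: (x - _) (y - _) => x' y' x'n y'n.
rewrite linearDl !linearDr /= abn // add0r !linearZl_LR !linearZr_LR /=.
by rewrite alt !scaler0 addr0 (bracketC e _ L) scalerN addrC.
Qed.

(** The torsion is the wedge product of the 1-form dual to [J e] with this
2-form, see [torsion_tau]. *)
Definition tau e (J : 'End(V)) y z := g (br e (J z)) y - g (br e (J y)) z.

Section Normal.
Variables (e : V) (brL : lie_bracket br) (ne : unit_normal e).
Local Notation D := (br e).

Let ee : g e e = 1. Proof. by case: ne. Qed.
Let brE x y : br x y = g x e *: D y - g y e *: D x. Proof. by case: ne. Qed.
Let De x : g (D x) e = 0. Proof. by case: ne. Qed.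
Let D0 : D e = 0. Proof. by case: brL. Qed.
Let DD x y : D (x + y) = D x + D y. Proof. exact: linearDr. Qed.
Let DB x y : D (x - y) = D x - D y. Proof. exact: linearBr. Qed.
Let DN x : D (- x) = - D x. Proof. exact: linearNr. Qed.
Let DZ k x : D (k *: x) = k *: D x. Proof. exact: linearZr_LR. Qed.

(** * One Hermitian structure on an almost abelian algebra *)

Section OneStructure.
Variables (J : 'End(V)) (H : hermitian_structure br J g).
Local Notation u := (J e).

Let JJ x : J (J x) = - x. Proof. by case: H => -[]. Qed.
Let gJ x y : g (J x) (J y) = g x y. Proof. by case: H. Qed.
Let Jskew x y : g (J x) y = - g x (J y). Proof. exact: dot_skew H. Qed.

Lemma dot_Jself x : g (J x) x = 0.
Proof.
have h : g (J x) x = - g (J x) x by rewrite {1}Jskew dotC.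
lra.
Qed.

Let ue : g u e = 0. Proof. exact: dot_Jself. Qed.
Let uu : g u u = 1. Proof. by rewrite gJ. Qed.
Let eu : g e u = 0. Proof. by rewrite dotC ue. Qed.

Lemma dotJ_normal x : g (J x) e = - g x u. Proof. exact: Jskew. Qed.

(** The Nijenhuis tensor at [e] and [x], both [x] and [J x] lying in the
abelian ideal. *)
Lemma DJ x : g x e = 0 -> g x u = 0 -> D (J x) = J (D x).
Proof.
move=> xe xu; case: H => -[_ /(_ e x)] + _.
rewrite (brE u (J x)) (brE u x) dot_Jself Jskew xu xe.
rewrite !(oppr0, scale0r, addr0, linear0, subr0, sub0r) => /eqP.
rewrite subr_eq0 => /eqP.
by move=> JDJ; rewrite -JDJ linearN /= JJ opprK.
Qed.

Lemma D_tangent x : g x e = 0 -> g x u = 0 -> g (D x) u = 0.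
Proof.
by move=> xe xu; apply: oppr_inj; rewrite -Jskew -DJ // De oppr0.
Qed.

Lemma torsion_tau x y z :
  torsion g br J x y z =
    g x u * tau e J y z + g y u * tau e J z x + g z u * tau e J x y.
Proof.
rewrite /torsion /tau (brE (J x)) (brE (J y)) (brE (J z)) !(Jskew _ e).
rewrite !(linearBl, linearZl_LR) /=; ring.
Qed.

Lemma torsion_normal x y :
  torsion g br J e x y = g x u * g (D u) y - g y u * g (D u) x.
Proof. rewrite torsion_tau eu /tau !De; ring. Qed.

(** Vectors are split along [e], [u] and their orthogonal complement.  Skewness
of [D] on the complement cancels in [tau] all but a multiple of the 2-form dual
to e and u, whose wedge product with the 1-form dual to [u] vanishes. *)
Lemma kahler_criterion :
    (forall x, g x e = 0 -> g x u = 0 -> g (D u) x = 0) ->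
    (forall x, g x e = 0 -> g x u = 0 -> g (D x) x = 0) ->
  forall x y z, torsion g br J x y z = 0.
Proof.
move=> Du Dskew.
have [p [pK pe pu]] : exists p : V -> V,
    [/\ forall x, x = p x + g x e *: e + g x u *: u,
        forall x, g (p x) e = 0 & forall x, g (p x) u = 0].
  exists (fun x => x - g x e *: e - g x u *: u).
  split=> x; first by rewrite addrAC !subrK.
    rewrite !linearBl /= !linearZl_LR /= ee ue; ring.
  rewrite !linearBl /= !linearZl_LR /= eu uu; ring.
have DJE x : D (J x) = J (D (p x)) + g x e *: D u.
  rewrite {1}(pK x) !linearD !linearZ /= JJ.
  by rewrite linearN /= D0 oppr0 scaler0 addr0 DJ.
pose a := g (D u) u.
have split v y : g v y = g v (p y) + g y e * g v e + g y u * g v u.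
  by rewrite {1}(pK y) !linearDr !linearZr_LR.
have DJdot x y : g (D (J x)) y = g (J (D (p x))) (p y) + g x e * g y u * a.
  rewrite DJE linearDl linearZl_LR /= (split (J _) y) (split (D u) y).
  rewrite (Du (p y)) // De dotJ_normal gJ De D_tangent // -/a; ring.
have sym x y : g (J (D (p x))) (p y) = g (J (D (p y))) (p x).
  have skew v w : g v e = 0 -> g v u = 0 -> g w e = 0 -> g w u = 0 ->
      g (D v) w = - g v (D w).
    move=> ve vu we wu.
    have vwe : g (v + w) e = 0 by rewrite linearDl /= ve we addr0.
    have vwu : g (v + w) u = 0 by rewrite linearDl /= vu wu addr0.
    have := Dskew _ vwe vwu.
    rewrite DD !dotDl !dotDr !Dskew // (dotC g (D w)); lra.
  rewrite Jskew skew ?opprK ?gJ ?dotJ_normal ?pu ?oppr0 //.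
  by rewrite DJ // dotC.
move=> x y z; rewrite torsion_tau /tau !DJdot.
rewrite (sym x y) (sym x z) (sym y z); ring.
Qed.

End OneStructure.

(** * Two complex structures with the same image of the normal *)

Section SameNormal.
Variables (J K : 'End(V)).
Hypotheses (HJ : hermitian_structure br J g) (HK : hermitian_structure br K g).
Hypothesis sumH : forall x y z, torsion g br J x y z + torsion g br K x y z = 0.
Hypothesis KeJe : K e = J e.
Local Notation u := (J e).

Let JJ x : J (J x) = - x. Proof. by case: HJ => -[]. Qed.
Let KK x : K (K x) = - x. Proof. by case: HK => -[]. Qed.
Let gJ x y : g (J x) (J y) = g x y. Proof. by case: HJ. Qed.
Let Jskew x y : g (J x) y = - g x (J y). Proof. exact: dot_skew HJ. Qed.
Let Kskew x y : g (K x) y = - g x (K y). Proof. exact: dot_skew HK. Qed.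
Let uu : g u u = 1. Proof. by rewrite gJ. Qed.
Let Ku : K u = - e. Proof. by rewrite -KeJe KK. Qed.

Lemma same_normal_Du x : g x e = 0 -> g x u = 0 -> g (D u) x = 0.
Proof.
move=> xe xu; have := sumH e u x.
rewrite (torsion_normal HJ) (torsion_normal HK) KeJe uu xu; lra.
Qed.

(** For L = J + K and z = L x, the vanishing of (T_J + T_K)(u, x, z) says that
g(D L z, x) = g(D z, z), whereas g(D L z, x) = g(L D z, x) = - g(D z, z). *)
Lemma same_normal_skew z :
  lker (J + K) = 0%VS -> g z e = 0 -> g z u = 0 -> g (D z) z = 0.
Proof.
move=> ker0 ze zu; pose L x := J x + K x.
have [x zE] : exists x, z = L x.
  exists ((J + K)^-1%VF z).
  have kL : lker (J + K) == 0%VS by rewrite ker0.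
  by rewrite /L -add_lfunE (lker0_lfunVK kL).
have Lskew v w : g (L v) w = - g v (L w).
  by rewrite /L dotDl dotDr Jskew Kskew opprD.
have xe : g x e = 0.
  move: zu; rewrite zE Lskew /L Ku JJ dotDr !dotNr; lra.
have xu : g x u = 0.
  move: ze; rewrite zE Lskew /L KeJe dotDr; lra.
have DL v : g v e = 0 -> g v u = 0 -> D (L v) = L (D v).
  by move=> ve vu; rewrite DD (DJ HJ ve vu) (DJ HK) // KeJe.
have := sumH u x z.
rewrite (torsion_tau HJ) (torsion_tau HK) KeJe uu xu zu /tau => sum0.
have sym : g (D (L z)) x = g (D (L x)) z by rewrite !DD !dotDl; lra.
move: sym; rewrite -zE DL // Lskew -zE; lra.
Qed.

(** Let [x] be killed by [J + K], and let [z] be orthogonal to e, u, x and J x.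
The commutator [C] is skew and kills e, u, x and J x, so [C z] lies in the
plane of z and J z; it is orthogonal to [z] by skewness, and to [J z] because
g(J K z, J z) and g(K J z, J z) both vanish. *)
Lemma same_normal_commute :
  \dim {:V} = 6%N -> lker (J + K) != 0%VS -> is_split J K.
Proof.
move=> dimV kerN0; pose x := vpick (lker (J + K)).
have x0 : x != 0 by rewrite vpick0.
have Kx : K x = - J x.
  apply/eqP; rewrite -addr_eq0 addrC -add_lfunE -memv_ker; exact: memv_pick.
have xu : g x u = 0.
  have := Kskew x e; rewrite KeJe Kx dotNl Jskew; lra.
have xe : g x e = 0.
  have := Kskew x u; rewrite Ku Kx dotNl Jskew JJ !dotNr; lra.
have KJx : K (J x) = x by rewrite -[J x]opprK -Kx linearN /= KK opprK.
have [|z z0 [_ zs]] := @exists_orthogonal _ _ g [:: e; u; x; J x] fullv.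
  by rewrite dimV.
have [ze zu zx zJx] : [/\ g z e = 0, g z u = 0, g z x = 0 & g z (J x) = 0].
  by split; apply: zs; rewrite !inE eqxx ?orbT.
pose C y := J (K y) - K (J y).
have Cskew y w : g (C y) w = - g y (C w).
  rewrite /C dotBl dotBr (Jskew (K y)) (Kskew y) (Kskew (J y)) (Jskew y); lra.
pose s := [:: e; u; x; J x; z; J z].
have basis w : {in s, forall y, g w y = 0} -> w = 0.
  apply: (@orthogonal_basis_eq0 _ _ g s fullv); rewrite ?memvf //.
  - rewrite !inE !negb_or !(eq_sym 0) -!(dot_eq0 g) !gJ ee oner_eq0.
    by rewrite !dot_eq0 x0 z0.
  - rewrite /= !gJ [g e u]dotC [g e x]dotC [g e (J x)]dotC [g e z]dotC.
    rewrite [g e (J z)]dotC [g u x]dotC [g u z]dotC [g x (J x)]dotC.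
    rewrite [g x z]dotC [g x (J z)]dotC [g (J x) z]dotC [g z (J z)]dotC.
    rewrite !(dot_Jself HJ) !(dotJ_normal HJ) (Jskew z x).
    by rewrite xe ze xu zu zx zJx !oppr0 !eqxx.
  - by move=> y; rewrite memvf.
have Ce : C e = 0 by rewrite /C KeJe JJ Ku subrr.
have Cu : C u = 0 by rewrite /C Ku JJ !linearN /= KeJe subrr.
have Cx : C x = 0 by rewrite /C Kx KJx linearN /= JJ opprK subrr.
have CJx : C (J x) = 0 by rewrite /C KJx JJ linearN /= Kx opprK subrr.
have C0 w : C w = 0 -> forall y, g (C y) w = 0.
  by move=> Cw y; rewrite Cskew Cw linear0r oppr0.
have Cself y : g (C y) y = 0.
  by have := Cskew y y; rewrite (dotC g y); lra.
have Cz : C z = 0.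
  apply: basis => y.
  rewrite !inE => /or4P[/eqP->|/eqP->|/eqP->|/or3P[/eqP->|/eqP->|/eqP->]];
    [exact: C0|exact: C0|exact: C0|exact: C0|exact: Cself|].
  by rewrite /C dotBl gJ !(dot_Jself HK) subr0.
have CJz : C (J z) = 0.
  apply: basis => y.
  by rewrite !inE => /or4P[/eqP->|/eqP->|/eqP->|/or3P[/eqP->|/eqP->|/eqP->]];
    [exact: C0|exact: C0|exact: C0|exact: C0|exact: C0|exact: Cself].
apply/lfunP => y; rewrite !comp_lfunE; apply/eqP; rewrite -subr_eq0; apply/eqP.
apply: basis => w.
by rewrite !inE => /or4P[/eqP->|/eqP->|/eqP->|/or3P[/eqP->|/eqP->|/eqP->]];
  exact: C0.
Qed.

Lemma same_normal_torsion0 : \dim {:V} = 6%N -> ~ is_split J K ->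
  forall x y z, torsion g br J x y z = 0.
Proof.
move=> dimV nsplit; have [ker0|kerN0] := eqVneq (lker (J + K)) 0%VS; last first.
  by case: nsplit; apply: same_normal_commute.
apply: (kahler_criterion HJ) => x xe xu; first exact: same_normal_Du.
exact: same_normal_skew.
Qed.

End SameNormal.

(** * Two complex structures with independent images of the normal *)

Definition torsion_closed (J : 'End(V)) :=
  let T := torsion g br J in
  forall x y z t, - T (br x y) z t + T (br x z) y t - T (br x t) y z
    - T (br y z) x t + T (br y t) x z - T (br z t) x y = 0.

(** The condition on the angle says that the unit vectors [J e] and [K e] are
not parallel. *)
Record transverse_pair (J K : 'End(V)) : Prop := TransversePair {
  transverse_l : hermitian_structure br J g;
  transverse_r : hermitian_structure br K g;
  transverse_torsion :
    forall x y z, torsion g br J x y z + torsion g br K x y z = 0;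
  transverse_closed_l : torsion_closed J;
  transverse_closed_r : torsion_closed K;
  transverse_angle : g (J e) (K e) ^+ 2 != 1 }.

Lemma transverse_sym J K : transverse_pair J K -> transverse_pair K J.
Proof.
case=> HJ HK sumH cJ cK ang; split=> //; last by rewrite dotC.
by move=> x y z; rewrite addrC.
Qed.

Definition rejection (J K : 'End(V)) := K e - g (J e) (K e) *: J e.

Lemma dot_rejection J K : hermitian_structure br J g ->
  g (rejection K J) (J e) = 1 - g (J e) (K e) ^+ 2.
Proof.
by case=> _ gJ; rewrite dotBl dotZl gJ ee (dotC g (K e)) expr2.
Qed.

Lemma dot_rejection_self J K : hermitian_structure br J g ->
  g (rejection J K) (J e) = 0.
Proof.
by case=> _ gJ; rewrite dotBl dotZl gJ ee (dotC g (K e)) mulr1 subrr.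
Qed.

(** This is the image under [D] of (1 - s^2) u = w' + s w, where w and w' are
the two rejections. *)
Lemma D_normal_rejection (J K : 'End(V)) k k' :
  let s := g (J e) (K e) in
  D (rejection J K) = k *: rejection J K ->
  D (rejection K J) = k' *: rejection K J ->
  (1 - s ^+ 2) *: D (J e) = k' *: rejection K J + (s * k) *: rejection J K.
Proof.
move=> s Dw Dw'; rewrite -scalerA -Dw -Dw' -!DZ -DD; congr (br e _).
rewrite /rejection (dotC g (K e)) -/s scalerBr scalerA addrA subrK -expr2.
by rewrite scalerBl scale1r.
Qed.

(** The vector [rejection K J] is orthogonal to [K e] and not to [J e], so
T_K drops out of T_J + T_K = 0 when it is the one argument outside of the
orthogonal complement of [J e] and [K e]. *)
Lemma transverse_Du J K y : transverse_pair J K ->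
  g y (J e) = 0 -> g y (K e) = 0 -> g (D (J e)) y = 0.
Proof.
move=> P yu yv; have HJ := transverse_l P; have HK := transverse_r P.
have := transverse_torsion P e (rejection K J) y.
rewrite (torsion_normal HJ) (torsion_normal HK) (dot_rejection _ HJ).
rewrite (dot_rejection_self _ HK) yu yv !mul0r !subr0 addr0 => /eqP.
by rewrite mulf_eq0 subr_eq0 eq_sym (negPf (transverse_angle P)) => /eqP.
Qed.

Lemma transverse_tau J K y z : transverse_pair J K ->
  g y (J e) = 0 -> g y (K e) = 0 -> g z (J e) = 0 -> g z (K e) = 0 ->
  tau e J y z = 0.
Proof.
move=> P yu yv zu zv; have HJ := transverse_l P; have HK := transverse_r P.
have := transverse_torsion P (rejection K J) y z.
rewrite (torsion_tau HJ) (torsion_tau HK) (dot_rejection _ HJ).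
rewrite (dot_rejection_self _ HK) yu yv zu zv !mul0r !addr0 => /eqP.
by rewrite mulf_eq0 subr_eq0 eq_sym (negPf (transverse_angle P)) => /eqP.
Qed.

Section Transverse.
Variables (J K : 'End(V)) (P : transverse_pair J K).
Local Notation u := (J e).
Local Notation v := (K e).
Local Notation s := (g u v).
Local Notation w := (rejection J K).
Local Notation w' := (rejection K J).

Let HJ : hermitian_structure br J g. Proof. by case: P. Qed.
Let HK : hermitian_structure br K g. Proof. by case: P. Qed.
Let JJ x : J (J x) = - x. Proof. by case: HJ => -[]. Qed.
Let gJ x y : g (J x) (J y) = g x y. Proof. by case: HJ. Qed.
Let Jskew x y : g (J x) y = - g x (J y). Proof. exact: dot_skew HJ. Qed.
Let uu : g u u = 1. Proof. by rewrite gJ. Qed.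
Let ue : g u e = 0. Proof. exact: dot_Jself HJ _. Qed.
Let ve : g v e = 0. Proof. exact: dot_Jself HK _. Qed.
Let s1 : 1 - s ^+ 2 != 0.
Proof. by rewrite subr_eq0 eq_sym; apply: transverse_angle P. Qed.
Let we : g w e = 0.
Proof. by rewrite dotBl dotZl ue ve mulr0 subr0. Qed.
Let wu : g w u = 0. Proof. exact: dot_rejection_self. Qed.
Let ww : g w w != 0.
Proof.
by rewrite [X in g w X]/rejection dotBr dotZr wu mulr0 subr0 dot_rejection // dotC.
Qed.
Let Jwe : g (J w) e = 0. Proof. by rewrite Jskew wu oppr0. Qed.
Let Jwu : g (J w) u = 0. Proof. by rewrite gJ we. Qed.

(** By [D_tangent], [D w] is orthogonal to e and u; by [transverse_Du] for both
pairs, it is orthogonal to everything that is orthogonal to u and v. *)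
Lemma transverse_Dw : exists k, D w = k *: w.
Proof.
exists (g (D w) w / g w w); set c := _ / _.
pose r := D w - c *: w.
have re : g r e = 0 by rewrite dotBl dotZl De we mulr0 subr0.
have ru : g r u = 0 by rewrite dotBl dotZl (D_tangent HJ) // wu mulr0 subr0.
have rw : g r w = 0 by rewrite dotBl dotZl /c divfK // subrr.
have rv : g r v = 0.
  by have := rw; rewrite dotBr dotZr ru mulr0 subr0.
apply/eqP; rewrite -subr_eq0 -/r -(dot_eq0 g); apply/eqP.
rewrite {1}/r dotBl dotZl (dotC g w) rw mulr0 subr0 DB DZ dotBl dotZl.
rewrite (transverse_Du P) // (transverse_Du (transverse_sym P)) //; ring.
Qed.

(** The closedness of T_J at (e, u, w, J w).  There only the brackets with e
are nonzero, and T_J(u, w, J w) = - 2 k g(w, w). *)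
Lemma transverse_eigen k k' : D w = k *: w -> D w' = k' *: w' ->
  k * (k' + 2 * k) = 0.
Proof.
move=> Dw Dw'.
have Duu : g (D u) u = k'.
  apply: (mulfI s1); rewrite -dotZl (D_normal_rejection Dw Dw') dotDl !dotZl.
  by rewrite wu dot_rejection // mulr0 addr0 mulrC.
have eu : g e u = 0 by rewrite dotC ue.
have DJw : D (J w) = k *: J w by rewrite (DJ HJ) // Dw linearZ.
have tau_w : tau e J w (J w) = - 2 * k * g w w.
  rewrite /tau JJ DN dotNl DJw dotZl gJ Dw dotZl; ring.
have tauC y z : tau e J y z = - tau e J z y by rewrite /tau opprB.
have := transverse_closed_l P e u w (J w).
have br0 x y : g x e = 0 -> g y e = 0 -> br x y = 0.
  by move=> xe ye; rewrite brE xe ye !scale0r subr0.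
rewrite (br0 u w) // (br0 u (J w)) // (br0 w (J w)) // DJw Dw.
have tauZ a y z : tau e J y (a *: z) = a * tau e J y z.
  rewrite /tau linearZ /= DZ dotZl dotZr; ring.
have tau0 : tau e J 0 e = 0 by rewrite /tau De linear0r subr0.
rewrite !(torsion_tau HJ) !dotZl !tauZ wu Jwu uu eu tau0 linear0l.
rewrite (tauC (J w) w) tau_w Duu => sum0; apply: (mulIf ww); rewrite mul0r.
by move: (g w w) sum0 => a sum0; lra.
Qed.

(** Here [D] kills u, w and J w, so by [kahler_criterion] only its skewness on
the complement of e, u, w and J w remains to be seen. *)
Lemma transverse_kernel_torsion0 : D w = 0 -> D w' = 0 ->
  forall x y z, torsion g br J x y z = 0.
Proof.
move=> Dw Dw'.
have Du0 : D u = 0.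
  have Dw0 : D w = 0 *: w by rewrite scale0r.
  have Dw'0 : D w' = 0 *: w' by rewrite scale0r.
  apply/eqP; have /eqP := D_normal_rejection Dw0 Dw'0.
  by rewrite mulr0 !scale0r addr0 scaler_eq0 (negPf s1).
apply: (kahler_criterion HJ) => [x _ _|x xe xu]; first by rewrite Du0 linear0l.
pose a := g x w / g w w; pose b := g x (J w) / g w w.
pose z := x - a *: w - b *: J w.
have Jww : g (J w) w = 0 by exact: dot_Jself HJ _.
have ze : g z e = 0 by rewrite !dotBl !dotZl xe we Jwe !mulr0 !subr0.
have zu : g z u = 0 by rewrite !dotBl !dotZl xu wu Jwu !mulr0 !subr0.
have zw : g z w = 0.
  by rewrite !dotBl !dotZl Jww /a divfK // mulr0 subr0 subrr.
have zJw : g z (J w) = 0.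
  by rewrite !dotBl !dotZl gJ (dotC g w) Jww /b divfK // mulr0 subr0 subrr.
have vE : v = w + s *: u by rewrite subrK.
have zv : g z v = 0 by rewrite vE dotDr dotZr zw zu mulr0 addr0.
have Jze : g (J z) e = 0 by rewrite Jskew zu oppr0.
have Jzu : g (J z) u = 0 by rewrite gJ ze.
have Jzv : g (J z) v = 0.
  by rewrite vE dotDr dotZr Jskew zJw Jzu mulr0 addr0 oppr0.
(* D preserves the orthogonal complements of {e, u} and of {e, v}. *)
have Dperp y : g y e = 0 -> g y u = 0 -> g y v = 0 -> g (D y) w = 0.
  move=> ye yu yv.
  by rewrite dotBr dotZr (D_tangent HJ) // (D_tangent HK) // mulr0 subr0.
have Dzz : g (D z) z = 0.
  have := transverse_tau P Jzu Jzv zu zv.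
  by rewrite /tau JJ DN (DJ HJ) // gJ dotNl; lra.
have DxE : D x = D z.
  by rewrite /z !DB !DZ (DJ HJ) // Dw !linear0 !addr0.
have xE : x = z + a *: w + b *: J w by rewrite /z addrAC !subrK.
rewrite DxE [X in g _ X]xE 2!dotDr !dotZr Dzz Dperp //.
by rewrite -[g _ (J _)]opprK -Jskew -(DJ HJ) // Dperp // oppr0 !mulr0 !addr0.
Qed.

End Transverse.

Lemma transverse_torsion0 J K : transverse_pair J K ->
  forall x y z, torsion g br J x y z = 0.
Proof.
move=> P; have Q := transverse_sym P.
have [k Dw] := transverse_Dw P; have [k' Dw'] := transverse_Dw Q.
have kk' := transverse_eigen P Dw Dw'; have k'k := transverse_eigen Q Dw' Dw.
have {kk' k'k} [k0 k'0] : k = 0 /\ k' = 0.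
  move/eqP: kk'; rewrite mulf_eq0 => /orP[/eqP k0|/eqP kk'].
    split=> //; apply/eqP; move: k'k; rewrite k0 add0r => /eqP.
    by rewrite !mulf_eq0 pnatr_eq0 orbb.
  move/eqP: k'k; rewrite mulf_eq0 => /orP[/eqP k'0|/eqP k'k]; lra.
by apply: (transverse_kernel_torsion0 P); rewrite ?Dw ?Dw' (k0, k'0) scale0r.
Qed.

End Normal.

(** * Generalized Kaehler structures *)

Lemma hermitian_structureN (J : 'End(V)) :
  hermitian_structure br J g -> hermitian_structure br (- J) g.
Proof.
case=> -[JJ NJ] gJ; split; [split|] => [x|x y|x y]; rewrite !opp_lfunE.
- by rewrite linearN /= opprK JJ.
- by rewrite -[RHS](NJ x y) !(linearNl, linearNr, linearN, opprK) /=.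
- by rewrite dotNl dotNr opprK gJ.
Qed.

Lemma torsionN J x y z : torsion g br (- J) x y z = torsion g br J x y z.
Proof. by rewrite /torsion !opp_lfunE !(linearNl, linearNr, opprK). Qed.

Lemma is_splitN (J K : 'End(V)) : is_split J (- K) -> is_split J K.
Proof.
move=> /lfunP JK; apply/lfunP => x; apply: oppr_inj.
by have := JK x; rewrite !comp_lfunE !opp_lfunE linearN.
Qed.

Lemma torsion_generalized_kahler J K : lie_bracket br ->
  generalized_kahler br J K g ->
  [/\ forall x y z, torsion g br J x y z + torsion g br K x y z = 0,
      torsion_closed J & torsion_closed K].
Proof.
move=> L [HJ HK sum dJ dK].
split=> [x y z|T x y z t|T x y z t].
- have := sum (vec3 x y z); rewrite (dc_fundamental_form _ L HJ).
  by rewrite (dc_fundamental_form _ L HK) !ffunE -rmorphD => -[].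
- by have := dJ (vec4 x y z t); rewrite ext_d_dc_fundamental // => -[].
- by have := dK (vec4 x y z t); rewrite ext_d_dc_fundamental // => -[].
Qed.

Lemma generalized_kahler_torsion0 J K e :
    \dim {:V} = 6%N -> lie_bracket br -> unit_normal e ->
    generalized_kahler br J K g -> ~ is_split J K ->
  forall x y z, torsion g br J x y z = 0.
Proof.
move=> dimV L ne GK nsplit; have [sum cJ cK] := torsion_generalized_kahler L GK.
have [HJ HK _ _ _] := GK.
have [ang|ang] := eqVneq (g (J e) (K e) ^+ 2) 1; last first.
  exact: (transverse_torsion0 L ne (TransversePair HJ HK sum cJ cK ang)).
have ee : g e e = 1 by case: ne.
have KeJe : K e = g (J e) (K e) *: J e.
  apply/eqP; rewrite -subr_eq0 -(dot_eq0 g) dotBl !dotBr !dotZl !dotZr.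
  rewrite (dotC g (K e) (J e)); move: (g (J e) (K e)) ang => s ang.
  case: HJ HK => _ -> [_ ->]; rewrite ee; apply/eqP; ring: ang.
move/eqP: ang; rewrite sqrf_eq1 => /orP[] /eqP ang.
  by apply: (same_normal_torsion0 L ne HJ HK) => //; rewrite KeJe ang scale1r.
apply: (same_normal_torsion0 L ne HJ (hermitian_structureN HK)) => //.
- by move=> x y z; rewrite torsionN.
- by rewrite opp_lfunE KeJe ang scaleN1r opprK.
- by move/is_splitN.
Qed.

End AlmostAbelian.

Theorem theorem5p1 (R : realType) (V : vectType R)
    (br : {bilinear V -> V -> V}) (br_lie : lie_bracket br)
    (dimV : \dim {: V} = 6%N) (br_aa : almost_abelian br)
    (no_kahler : ~ exists (J : 'End(V)) (g : {dot V for idfun}), kahler br J g) :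
  ~ exists (Jp Jm : 'End(V)) (g : {dot V for idfun}),
      generalized_kahler br Jp Jm g /\ ~ is_split Jp Jm.
Proof.
move=> [Jp [Jm [g [GK nsplit]]]]; apply: no_kahler; exists Jp, g.
have [e ne] := exists_unit_normal g br_lie br_aa.
apply: kahler_torsion0 => //; first by case: GK.
exact: generalized_kahler_torsion0 ne GK nsplit.
Qed.
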